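(* Given a matroid $M=(S,\mathcal{I})$ (by an independence oracle), a set $S_0\subseteq S$ containing a basis, and $w\in\mathbb{R}^S$, an optimal weight function for the IM-Exists instance $(M,S_0,w,\|\cdot\|_\infty)$ can be computed in polynomial time (by a binary search over candidate values of the form $\pm(w(e)-w(f))/2$ with $e\in S_0$, $f\in S\setminus S_0$).
   Context: IM-Exists problem: find $w^*\in\mathbb{R}^S$ such that some basis of $M$ contained in $S_0$ is a maximum $w^*$-weight basis of $M$, minimizing $\|w-w^*\|_\infty=\max_s|w(s)-w^*(s)|$. Polynomial time means polynomially many (in $|S|$) independence oracle calls and elementary operations. *)

(* Defs.v *)
From mathcomp Require Import all_boot all_order all_algebra.
From mathcomp Require Import reals.

Set Implicit Arguments.
Unset Strict Implicit.
Unset Printing Implicit Defensive.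

Import Order.TTheory GRing.Theory Num.Theory.
Local Open Scope ring_scope.

Record matroid (T : finType) := Matroid {
  indep : {set T} -> bool;
  indep0 : indep set0;
  indepS : forall A B : {set T}, A \subset B -> indep B -> indep A;
  indep_aug : forall A B : {set T}, indep A -> indep B -> (#|A| < #|B|)%N ->
    exists2 x, x \in B :\: A & indep (x |: A)
}.

Definition basis (T : finType) (M : matroid T) (B : {set T}) : bool :=
  maxset (indep M) B.

Definition weight (R : realType) (T : finType) (w : T -> R) (B : {set T}) : R :=
  \sum_(s in B) w s.

Definition max_weight_basis (R : realType) (T : finType) (M : matroid T)
    (w : T -> R) (B : {set T}) : Prop :=
  basis M B /\ forall B', basis M B' -> weight w B' <= weight w B.

(* Every term is nonnegative, so the default value 0 only matters when T is
   empty. *)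
Definition dist_inf (R : realType) (T : finType) (w v : T -> R) : R :=
  \big[Num.max/0]_(s : T) `|w s - v s|.

Definition IM_feasible (R : realType) (T : finType) (M : matroid T)
    (S0 : {set T}) (v : T -> R) : Prop :=
  exists B : {set T}, B \subset S0 /\ max_weight_basis M v B.

Definition IM_optimal (R : realType) (T : finType) (M : matroid T)
    (S0 : {set T}) (w v : T -> R) : Prop :=
  IM_feasible M S0 v /\
  forall u : T -> R, IM_feasible M S0 u -> dist_inf w v <= dist_inf w u.

(* The value 0 is needed as well: it is the optimum when w itself is feasible,
   and then it need not be a half-difference of weights. *)
Definition candidate (R : realType) (T : finType) (S0 : {set T}) (w : T -> R)
    (d : R) : Prop :=
  d = 0 \/
  exists e f : T, [/\ e \in S0, f \notin S0 &
    d = (w e - w f) / 2 \/ d = - ((w e - w f) / 2)].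

(* Oracle algorithms are programs of a real-number random access machine with
   arrays of natural numbers (for indices and sets) and arrays of reals.
   Programs are finite syntax, so one program handles all input sizes, and the
   only real constants are natural numbers. Multiplication of naturals is left
   out so that a short run cannot build naturals of exponential length. *)
Inductive nexpr :=
  | NConst of nat
  | NGet of nat & nexpr          (* array name, index *)
  | NAdd of nexpr & nexpr
  | NSub of nexpr & nexpr.       (* truncated *)

Inductive rexpr :=
  | RConst of nat
  | RGet of nat & nexpr
  | RAdd of rexpr & rexpr
  | RSub of rexpr & rexpr
  | RMul of rexpr & rexpr
  | RDiv of rexpr & rexpr.       (* division by 0 returns 0 *)

Inductive bexpr :=
  | BNle of nexpr & nexpr
  | BRle of rexpr & rexpr
  | BNot of bexpr
  | BAnd of bexpr & bexpr
  | BIndep of nat.               (* oracle call on the set stored in an array *)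

Inductive cmd :=
  | Skip
  | Seq of cmd & cmd
  | NSet of nat & nexpr & nexpr  (* array name, index, value *)
  | RSet of nat & nexpr & rexpr
  | If of bexpr & cmd & cmd
  | While of bexpr & cmd.

Record state (R : realType) := State {
  nmem : nat -> nat -> nat;
  rmem : nat -> nat -> R
}.

Definition upd (A : Type) (m : nat -> nat -> A) (a i : nat) (x : A) :
    nat -> nat -> A :=
  fun b j => if (b == a) && (j == i) then x else m b j.

Fixpoint neval (R : realType) (s : state R) (e : nexpr) : nat :=
  match e with
  | NConst k => k
  | NGet a i => nmem s a (neval s i)
  | NAdd e1 e2 => (neval s e1 + neval s e2)%N
  | NSub e1 e2 => (neval s e1 - neval s e2)%N
  end.

Fixpoint reval (R : realType) (s : state R) (e : rexpr) : R :=
  match e with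
  | RConst k => k%:R
  | RGet a i => rmem s a (neval s i)
  | RAdd e1 e2 => reval s e1 + reval s e2
  | RSub e1 e2 => reval s e1 - reval s e2
  | RMul e1 e2 => reval s e1 * reval s e2
  | RDiv e1 e2 => reval s e1 / reval s e2
  end.

(* An oracle answers queries given by characteristic functions on indices. *)
Definition oracle := (nat -> bool) -> bool.

Fixpoint beval (O : oracle) (R : realType) (s : state R) (b : bexpr) : bool :=
  match b with
  | BNle e1 e2 => (neval s e1 <= neval s e2)%N
  | BRle e1 e2 => reval s e1 <= reval s e2
  | BNot b1 => ~~ beval O s b1
  | BAnd b1 b2 => beval O s b1 && beval O s b2
  | BIndep a => O (fun i => nmem s a i != 0%N)
  end.

(* Costs: one unit for each memory access, operation, comparison, assignment
   and oracle call. *)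
Fixpoint ncost (e : nexpr) : nat :=
  match e with
  | NConst _ => 1
  | NGet _ i => (ncost i).+1
  | NAdd e1 e2 | NSub e1 e2 => (ncost e1 + ncost e2).+1
  end.

Fixpoint rcost (e : rexpr) : nat :=
  match e with
  | RConst _ => 1
  | RGet _ i => (ncost i).+1
  | RAdd e1 e2 | RSub e1 e2 | RMul e1 e2 | RDiv e1 e2 =>
      (rcost e1 + rcost e2).+1
  end.

Fixpoint bcost (b : bexpr) : nat :=
  match b with
  | BNle e1 e2 => (ncost e1 + ncost e2).+1
  | BRle e1 e2 => (rcost e1 + rcost e2).+1
  | BNot b1 => (bcost b1).+1
  | BAnd b1 b2 => (bcost b1 + bcost b2).+1
  | BIndep _ => 1
  end.

(* [exec O c s t s']: from [s], with oracle [O], the program [c] halts in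
   state [s'] at total cost [t]. *)
Inductive exec (O : oracle) (R : realType) :
    cmd -> state R -> nat -> state R -> Prop :=
  | ExecSkip s : exec O Skip s 1 s
  | ExecSeq c1 c2 s t1 s1 t2 s2 :
      exec O c1 s t1 s1 -> exec O c2 s1 t2 s2 ->
      exec O (Seq c1 c2) s (t1 + t2) s2
  | ExecNSet a i e s :
      exec O (NSet a i e) s (ncost i + ncost e).+1
        (State (upd (nmem s) a (neval s i) (neval s e)) (rmem s))
  | ExecRSet a i e s :
      exec O (RSet a i e) s (ncost i + rcost e).+1
        (State (nmem s) (upd (rmem s) a (neval s i) (reval s e)))
  | ExecIf b c1 c2 s t s' :
      exec O (if beval O s b then c1 else c2) s t s' ->
      exec O (If b c1 c2) s (bcost b + t) s'
  | ExecWhileFalse b c s :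
      ~~ beval O s b -> exec O (While b c) s (bcost b) s
  | ExecWhileTrue b c s t1 s1 t2 s2 :
      beval O s b -> exec O c s t1 s1 -> exec O (While b c) s1 t2 s2 ->
      exec O (While b c) s (bcost b + t1 + t2) s2.

Lemma exec_det (O : oracle) (R : realType) (c : cmd) (s : state R)
    (t1 t2 : nat) (s1 s2 : state R) :
  exec O c s t1 s1 -> exec O c s t2 s2 -> t1 = t2 /\ s1 = s2.
Proof.
move=> H; elim: H t2 s2 => {c s t1 s1}.
- by move=> s t2 s2 H; inversion H.
- move=> c1 c2 s t1 s1 t2 s2 _ IH1 _ IH2 t s' H; inversion H; subst.
  have [? ?] := IH1 _ _ ltac:(eassumption); subst.
  by have [? ?] := IH2 _ _ ltac:(eassumption); subst.
- by move=> a i e s t2 s2 H; inversion H.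
- by move=> a i e s t2 s2 H; inversion H.
- move=> b c1 c2 s t s' _ IH t2 s2 H; inversion H; subst.
  by have [? ?] := IH _ _ ltac:(eassumption); subst.
- by move=> b c s /negPf Hb t2 s2 H; inversion H; subst => //; congruence.
- move=> b c s t1 s1 t2 s2 Hb _ IH1 _ IH2 t s' H; inversion H; subst.
    by match goal with H : is_true (~~ _) |- _ => rewrite Hb in H end.
  have [? ?] := IH1 _ _ ltac:(eassumption); subst.
  by have [? ?] := IH2 _ _ ltac:(eassumption); subst.
Qed.

(* The elements of T are named 0, ..., #|T|-1 along [enum T]; entries of the
   queried array beyond that range are ignored. *)
Definition indep_oracle (T : finType) (M : matroid T) : oracle :=
  fun chi => indep M [set x | chi (enum_rank x)].

(* Input: nat array 0 holds #|T| at index 0, nat array 1 the characteristic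
   vector of S0, real array 0 the weights; everything else is 0. *)
Definition IM_input (R : realType) (T : finType) (S0 : {set T}) (w : T -> R) :
    state R :=
  {| nmem := fun a i =>
       if a == 0%N then (if i == 0%N then #|T| else 0%N)
       else if a == 1%N then
         (if insub i is Some j then nat_of_bool (enum_val (j : 'I_#|T|) \in S0)
          else 0%N)
       else 0%N;
     rmem := fun a i =>
       if a == 0%N then
         (if insub i is Some j then w (enum_val (j : 'I_#|T|)) else 0)
       else 0 |}.

(* Output: the contents of real array 1. *)
Definition IM_output (R : realType) (T : finType) (s : state R) : T -> R :=
  fun x => rmem s 1%N (enum_rank x).

(* Main.v *)
(* Write cl for the closure operator of M. A weight v is feasible iff every f
   outside S0 lies in cl {e in S0 : v e >= v f}. Hence, if some feasible v is at
   distance at most d from w, then raising w by d on S0 and lowering it by d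
   elsewhere is also feasible. The least such d is the maximum of 0 and the
   values (w f - w e)/2 over the pairs e in S0, f not in S0 with f not in
   cl {e' in S0 : w e' > w e}. For each e, one greedy pass builds an independent
   set spanning {e' in S0 : w e' > w e}, and then one oracle call per f decides
   membership in its closure; so a direct scan over all pairs is polynomial and
   no binary search is needed. *)
Require Import Defs.
From mathcomp Require Import all_boot all_order all_algebra.
From mathcomp Require Import reals.
From mathcomp Require Import zify lra.

Set Implicit Arguments.
Unset Strict Implicit.
Unset Printing Implicit Defensive.

Import Order.TTheory GRing.Theory Num.Theory.

(** * Bases of subsets and closure in a matroid *)

Section Span.
Variables (T : finType) (M : matroid T).
Implicit Types (A B I J : {set T}) (x e f : T).

Definition basis_in A I : bool := maxset [pred J | indep M J & J \subset A] I.

(** For [f] outside [A] this is membership of [f] in the closure of [A]. For [f] in [A] it can fail,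
    since [f |: I] may equal [I]; hence the hypotheses [f \notin A] below. *)
Definition spans A f : bool := [exists I, basis_in A I && ~~ indep M (f |: I)].

Lemma basis_inP A I :
  reflect [/\ indep M I, I \subset A &
             forall x, x \in A -> x \notin I -> ~~ indep M (x |: I)]
          (basis_in A I).
Proof.
apply: (iffP maxsetP) => [[/andP[iI sIA] maxI]|[iI sIA maxI]]; split => //=.
- move=> x xA xI; apply/negP => iJ.
  have sJ : x |: I \subset A by rewrite subUset sub1set xA.
  have := maxI (x |: I); rewrite /= iJ sJ subsetUr => /(_ isT isT) E.
  by rewrite -E setU11 in xI.
- by rewrite iI.
- move=> J /andP[iJ sJA] sIJ; apply/eqP; rewrite eq_sym eqEsubset sIJ /=.
  apply/subsetP => x xJ; apply: contraT => xI.
  move/negP: (maxI x (subsetP sJA _ xJ) xI); case; apply: indepS iJ.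
  by rewrite subUset sub1set xJ.
Qed.

Lemma basis_in_exists A I : indep M I -> I \subset A ->
  exists2 J, basis_in A J & I \subset J.
Proof.
move=> iI sIA; have /maxset_exists[J] : [pred J | indep M J & J \subset A] I.
  by rewrite /= iI.
by exists J.
Qed.

Lemma leq_card_basis_in A I J :
  indep M I -> I \subset A -> basis_in A J -> (#|I| <= #|J|)%N.
Proof.
move=> iI sIA /basis_inP[iJ sJA maxJ]; rewrite leqNgt; apply/negP => lt.
have [x /setDP[xI xJ] ix] := indep_aug iJ iI lt.
by move/negP: (maxJ x (subsetP sIA _ xI) xJ).
Qed.

(** One basis of [A] suffices for the test. If [f |: I] were independent, it would be larger than
    any other basis [J] of [A], so [J] could be augmented from it. Maximality of [J] excludes
    augmenting by an element of [I], so [f |: J] would be independent too. *)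
Lemma spansE A I f : f \notin A -> basis_in A I -> spans A f = ~~ indep M (f |: I).
Proof.
move=> fA bI; apply/existsP/idP => [[J /andP[bJ]]|di]; last first.
  by exists I; rewrite bI.
apply: contra => ifI; have [iI sIA _] := basis_inP _ _ bI.
have [iJ sJA maxJ] := basis_inP _ _ bJ.
have lt : (#|J| < #|f |: I|)%N.
  rewrite cardsU1 (contra (subsetP sIA f) fA) add1n ltnS.
  exact: leq_card_basis_in sJA bI.
have [x /setDP[/setU1P[-> //|xI] xJ] ix] := indep_aug iJ ifI lt.
by move/negP: (maxJ x (subsetP sIA _ xI) xJ).
Qed.

(** A basis of [A] extends to a basis of [B], and dependence passes to supersets. *)
Lemma spansS A B f : A \subset B -> f \notin B -> spans A f -> spans B f.
Proof.
move=> sAB fB /existsP[I /andP[bI di]].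
have [iI sIA _] := basis_inP _ _ bI.
have [J bJ sIJ] := basis_in_exists iI (subset_trans sIA sAB).
rewrite (spansE fB bJ); apply: contra di; apply: indepS; exact: setUS.
Qed.

Lemma basis_basis_in B : basis M B = basis_in setT B.
Proof.
apply/maxsetP/maxsetP => -[/= iB maxB]; split; rewrite ?subsetT ?andbT // in iB *.
  by move=> J /andP[iJ _]; apply: maxB.
by move=> J iJ; apply: maxB; rewrite iJ subsetT.
Qed.

Lemma basis_card_eq B I :
  basis M B -> indep M I -> #|I| = #|B| -> basis M I.
Proof.
rewrite !basis_basis_in => bB iI E; apply/basis_inP; split => [//||x _ xI].
  exact: subsetT.
apply/negP => ix; have := leq_card_basis_in ix (subsetT _) bB.
by rewrite cardsU1 xI E add1n ltnn.
Qed.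

Lemma span_of_basis A B f : basis M B -> B \subset A -> f \notin A -> spans A f.
Proof.
rewrite basis_basis_in => /basis_inP[iB _ maxB] sBA fA.
have bB : basis_in A B by apply/basis_inP; split => // x _; apply: maxB.
by rewrite (spansE fA bB); apply: maxB => //; apply: contra fA; apply: subsetP.
Qed.

End Span.

(** * Feasible weights, and optimality of a uniform shift *)

Section Feasible.
Variables (R : realType) (T : finType) (M : matroid T).
Implicit Types (A B I J S : {set T}) (x e f : T) (v w u : T -> R).
Local Open Scope ring_scope.

Lemma weightU1 v B e : e \notin B -> weight v (e |: B) = v e + weight v B.
Proof. by move=> eB; rewrite /weight big_setU1. Qed.

(* If f were not spanned by the elements of B at least as heavy as f, it could
   replace a lighter element of B. *)
Lemma feasible_span S v f : f \notin S -> IM_feasible M S v ->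
  spans M [set e in S | v f <= v e] f.
Proof.
move=> fS [B [sBS [bB maxB]]]; pose A := [set e in B | v f <= v e].
have fB : f \notin B by apply: contra fS; apply: subsetP.
have sAS : A \subset [set e in S | v f <= v e].
  by apply/subsetP => e; rewrite !inE => /andP[/(subsetP sBS) -> ->].
have iB : indep M B by have /maxsetP[] := bB.
apply: spansS sAS _ _; first by rewrite inE negb_and fS.
have bA : basis_in M A A.
  apply/basis_inP; split => // [|x -> //]; apply: indepS iB.
  by apply/subsetP => e; rewrite inE => /andP[].
rewrite (spansE _ bA) ?inE ?negb_and ?fB //; apply/negP => ifA.
have sfA : f |: A \subset f |: B.
  by apply/setUS/subsetP => e; rewrite inE => /andP[].
(* If [f |: A] is independent, it extends to a basis [J] of [f |: B]. By cardinality [J] is [B] with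
   one element [e] replaced by [f]. Since [A] lies in [J], this [e] is outside [A], so [v e < v f]
   and [J] outweighs [B]. *)
have [J bJ sAJ] := basis_in_exists ifA sfA.
have [iJ sJ _] := basis_inP _ _ _ bJ.
have cJ : #|J| = #|B|.
  apply/eqP; rewrite eqn_leq (leq_card_basis_in iB _ bJ) ?subsetUr // andbT.
  by rewrite basis_basis_in in bB; apply: leq_card_basis_in bB.
have := maxB _ (basis_card_eq bB iJ cJ); apply/negP; rewrite -ltNge.
have fJ : f \in J by apply: (subsetP sAJ); rewrite setU11.
have sDB : J :\ f \subset B.
  apply/subsetP => x /setD1P[xf /(subsetP sJ)/setU1P[xf'|//]].
  by rewrite xf' eqxx in xf.
have cD : #|B :\: (J :\ f)| = 1%N.
  by rewrite cardsDS // -cJ (cardsD1 f J) fJ addnK.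
have /eqP/cards1P[e De] := cD.
have /setDP[eB eD] : e \in B :\: (J :\ f) by rewrite De set11.
have EB : B = e |: (J :\ f).
  by rewrite -{1}(setID B (J :\ f)) (setIidPr sDB) De setUC.
have wJ : weight v J = v f + weight v (J :\ f).
  by rewrite -{1}(setD1K fJ) weightU1 ?setD11.
rewrite EB weightU1 // wJ ltrD2r.
rewrite ltNge; apply/negP => le.
have : e \in J by apply: (subsetP sAJ); rewrite !inE eB le orbT.
by move=> eJ; rewrite !inE eJ andbT negbK in eD; rewrite -(eqP eD) eB in fB.
Qed.

(** A heaviest basis [B] inside [S] is heaviest overall: any basis [B'] can be moved into [S]
    without losing weight, one exchange at a time, by induction on the size of [B' :\: S]. *)
Lemma span_feasible S v : (exists2 B, basis M B & B \subset S) ->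
  (forall f, f \notin S -> spans M [set e in S | v f <= v e] f) ->
  IM_feasible M S v.
Proof.
move=> [B0 bB0 sB0] sp.
pose P B := basis M B && (B \subset S).
have PB0 : P B0 by rewrite /P bB0.
case: (@arg_maxP _ _ _ _ P (weight v) PB0) => B /andP[bB sBS] maxB.
exists B; split=> //; split=> // B'.
have [n] := ubnP #|B' :\: S|; elim: n B' => // n IHn B' ltn bB'.
have [/eqP/[!setD_eq0] sB'|/set0Pn[f /setDP[fB' fS]]] := eqVneq (B' :\: S) set0.
  by apply: maxB; rewrite /P bB'.
pose A := [set e in S | v f <= v e]; pose C := B' :\ f.
have iB' : indep M B' by have /maxsetP[] := bB'.
have iC : indep M C by apply: indepS iB'; apply: subsetDl.
(* Without such an [e], [C] would be a basis of [C :|: A]. As [A] spans [f], so does [C :|: A], and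
   [f |: C], which is [B'], would be dependent. *)
have [e /andP[eA eC] ie] : exists2 e, (e \in A) && (e \notin C) & indep M (e |: C).
  apply/exists_inP; apply: contraT => /exists_inPn no.
  have bC : basis_in M (C :|: A) C.
    apply/basis_inP; split => // [|x /setUP[->//|xA] xC]; first exact: subsetUl.
    by apply: no; rewrite unfold_in /= xA.
  have fU : f \notin C :|: A by rewrite !inE eqxx (negPf fS).
  have := spansS (subsetUr C A) fU (sp f fS).
  by rewrite (spansE fU bC) setD1K // iB'.
move: eA; rewrite inE => /andP[eS le].
have cE : #|e |: C| = #|B'| by rewrite cardsU1 eC (cardsD1 f B') fB'.
have bE : basis M (e |: C) := basis_card_eq bB' ie cE.
apply: (@le_trans _ _ (weight v (e |: C))).
  by rewrite -{1}(setD1K fB') !weightU1 ?setD11 // lerD2r.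
apply: IHn => //; rewrite -ltnS; apply: leq_trans ltn; rewrite ltnS.
apply: proper_card; apply/properP; split.
  apply/subsetP => x; rewrite !inE => /andP[xS /orP[/eqP xe|/andP[_ ->]]].
    by rewrite xe eS in xS.
  by rewrite xS.
exists f; rewrite !inE ?fS // eqxx orbF /=; apply: contra fS => /eqP ->.
exact: eS.
Qed.

Definition heavier S w e := [set e' in S | w e < w e'].

Definition shift S w (d : R) : T -> R :=
  fun x => if x \in S then w x + d else w x - d.

(** Let [X] be the part of [S] that is at least as heavy as [f] after the shift, and [e] a
    [w]-heaviest element of [S] outside [X]. All strictly heavier elements are in [X], so if [X] did
    not span [f], neither would [heavier S w e]. The bound on the half gap would then put [e] in
    [X]. *)
Lemma shift_feasible S w (d : R) : (exists2 B, basis M B & B \subset S) ->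
  (forall e f, e \in S -> f \notin S -> ~~ spans M (heavier S w e) f ->
     (w f - w e) / 2 <= d) ->
  IM_feasible M S (shift S w d).
Proof.
move=> exB le_d; apply: span_feasible => // f fS.
set X := [set e in S | _]; have [sSX|] := boolP (S \subset X).
  have [B bB sBS] := exB.
  apply: (span_of_basis bB); first exact: subset_trans sSX.
  by rewrite inE (negPf fS).
case/subsetPn => e0 e0S e0X.
have P0 : [pred e in S :\: X] e0 by rewrite /= inE e0X.
case: (arg_maxP w P0) => e /setDP[eS eX] maxe.
have sAX : heavier S w e \subset X.
  apply/subsetP => e'; rewrite inE => /andP[e'S lt]; apply: contraT => e'X.
  have /maxe : e' \in S :\: X by apply/setDP.
  by rewrite /= leNgt lt.
apply: spansS sAX _ _; first by rewrite inE (negPf fS).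
apply: contraT => /(le_d _ _ eS fS).
move: eX; rewrite inE eS /= /shift eS (negPf fS) -ltNge; lra.
Qed.

Lemma ler_dist_inf w u x : `|w x - u x| <= dist_inf w u.
Proof. exact: le_bigmax. Qed.

Lemma dist_inf_ge0 w u : 0 <= dist_inf w u.
Proof. exact: bigmax_ge_id. Qed.

(** Let D be the distance. If [u e' >= u f] then [w e' >= w f - 2D]. Were the half gap larger than
    D, each such [e'] would be in [heavier S w e], and this set would span [f]. *)
Lemma feasible_dist_inf S w u e f :
  f \notin S -> ~~ spans M (heavier S w e) f ->
  IM_feasible M S u -> (w f - w e) / 2 <= dist_inf w u.
Proof.
move=> fS nsp feas; rewrite leNgt; apply: contra nsp => lt.
apply: spansS (feasible_span fS feas); last by rewrite inE (negPf fS).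
apply/subsetP => e'; rewrite !inE => /andP[-> le] /=.
have := ler_dist_inf w u e'; have := ler_dist_inf w u f.
rewrite !ler_norml => /andP[? ?] /andP[? ?]; lra.
Qed.

(** The element [x] witnesses that [T] is nonempty; on an empty type the distance is 0 whatever [d]
    is. *)
Lemma dist_inf_shift S w (d : R) x : 0 <= d -> dist_inf w (shift S w d) = d.
Proof.
move=> d0; have E y : `|w y - shift S w d y| = d.
  rewrite /shift; case: ifP => _;
    by rewrite opprD ?opprK addrA subrr add0r ?normrN ger0_norm.
apply/le_anti/andP; split; last by rewrite -{1}(E x) ler_dist_inf.
by apply: bigmax_le => // y _; rewrite E.
Qed.

Lemma dist_inf_shift0 S w : dist_inf w (shift S w 0) = 0.
Proof.
apply: big1_idem => [|y _]; first exact: maxxx.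
by rewrite /shift; case: ifP; rewrite ?subr0 ?addr0 subrr normr0.
Qed.

End Feasible.

(** * Total correctness with cost bounds for programs *)

Section Programs.
Variables (O : oracle) (R : realType).
Implicit Types (c : cmd) (s : state R) (Q : state R -> Prop).

Definition runs c s k Q := exists t s', [/\ exec O c s t s', (t <= k)%N & Q s'].

Lemma runs_weaken c s k k' Q Q' :
  runs c s k Q -> (k <= k')%N -> (forall s', Q s' -> Q' s') -> runs c s k' Q'.
Proof.
move=> [t [s' [ex tk Qs]]] kk' QQ'; exists t, s'; split; auto.
exact: leq_trans kk'.
Qed.

Lemma runs_seq c1 c2 s k1 k2 Q :
  runs c1 s k1 (fun s1 => runs c2 s1 k2 Q) -> runs (Seq c1 c2) s (k1 + k2) Q.
Proof.
move=> [t1 [s1 [ex1 le1 [t2 [s2 [ex2 le2 Qs]]]]]].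
exists (t1 + t2)%N, s2; split; [exact: ExecSeq ex1 ex2 | exact: leq_add | by []].
Qed.

Lemma runs_if b c1 c2 s k Q :
  runs (if beval O s b then c1 else c2) s k Q ->
  runs (If b c1 c2) s (bcost b + k) Q.
Proof.
move=> [t [s' [ex le Qs]]].
by exists (bcost b + t)%N, s'; split; [exact: ExecIf | rewrite leq_add2l |].
Qed.

Fixpoint loop_free c : bool :=
  match c with
  | While _ _ => false
  | Seq c1 c2 | If _ c1 c2 => loop_free c1 && loop_free c2
  | _ => true
  end.

(* Junk value on loops. *)
Fixpoint run c s : state R :=
  match c with
  | Skip | While _ _ => s
  | Seq c1 c2 => run c2 (run c1 s)
  | NSet a i e => State (upd (nmem s) a (neval s i) (neval s e)) (rmem s)
  | RSet a i e => State (nmem s) (upd (rmem s) a (neval s i) (reval s e))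
  | If b c1 c2 => if beval O s b then run c1 s else run c2 s
  end.

Fixpoint run_cost c : nat :=
  match c with
  | Skip | While _ _ => 1
  | Seq c1 c2 => run_cost c1 + run_cost c2
  | NSet _ i e => (ncost i + ncost e).+1
  | RSet _ i e => (ncost i + rcost e).+1
  | If b c1 c2 => bcost b + maxn (run_cost c1) (run_cost c2)
  end.

Lemma runs_loop_free c s k Q :
  loop_free c -> (run_cost c <= k)%N -> Q (run c s) -> runs c s k Q.
Proof.
move=> lf le_k Qs.
suff [t ex le] : exists2 t, exec O c s t (run c s) & (t <= run_cost c)%N.
  by exists t, (run c s); split=> //; exact: leq_trans le_k.
elim: c s lf {Qs le_k} => //=.
- by move=> s _; exists 1%N => //; exact: ExecSkip.
- move=> c1 IH1 c2 IH2 s /andP[lf1 lf2].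
  have [t1 ex1 le1] := IH1 s lf1; have [t2 ex2 le2] := IH2 (run c1 s) lf2.
  by exists (t1 + t2)%N; [exact: ExecSeq ex1 ex2 | exact: leq_add].
- by move=> a i e s _; eexists; [exact: ExecNSet | by []].
- by move=> a i e s _; eexists; [exact: ExecRSet | by []].
- move=> b c1 IH1 c2 IH2 s /andP[lf1 lf2].
  have [t1 ex1 le1] := IH1 s lf1; have [t2 ex2 le2] := IH2 s lf2.
  exists (bcost b + if beval O s b then t1 else t2)%N.
    by apply: ExecIf; case: (beval O s b).
  rewrite leq_add2l leq_max; case: (beval O s b); by rewrite ?le1 ?le2 ?orbT.
Qed.

Definition counter a := NGet a (NConst 0).

Definition For a c :=
  Seq (NSet a (NConst 0) (NConst 0))
      (While (BNot (BNle (counter 0) (counter a)))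
         (Seq c (NSet a (NConst 0) (NAdd (counter a) (NConst 1))))).

Definition set_counter a j s := State (upd (nmem s) a 0%N j) (rmem s).

(** Each guard test costs 6 and each increment 6, whence 12 per round on top of the body. The 9 pays
    for the initial assignment (3) and the last, failing test (6). *)
Lemma runs_for a c s k n (Inv : nat -> state R -> Prop) :
  Inv 0%N (set_counter a 0 s) ->
  (forall j s, Inv j s -> nmem s 0 0 = n /\ nmem s a 0 = j) ->
  (forall j s, (j < n)%N -> Inv j s ->
     runs c s k (fun s' => Inv j.+1 (set_counter a (nmem s' a 0%N + 1) s'))) ->
  runs (For a c) s (n * (k + 12) + 9) (Inv n).
Proof.
move=> Inv0 InvE step; rewrite addnC.
apply: (@runs_weaken _ _ (3 + (n * (k + 12) + 6))%N _ (Inv n)) => //; last by lia.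
apply: runs_seq; exists 3%N, (set_counter a 0 s); split=> //.
  by have := ExecNSet O a (NConst 0) (NConst 0) s.
move: (set_counter a 0 s) Inv0 => {}s.
rewrite -{1}(subnn n); have: (n <= n)%N by [].
(* Induction on the number [m] of rounds left, with the counter at [n - m]. *)
move: {1 4 5}n => m; elim: m s => [|m IHm] s lemn.
  rewrite subn0 => /[dup] /InvE[En Ea] Is.
  exists 6%N, s; split=> //; first by apply: ExecWhileFalse; rewrite /= En Ea leqnn.
move=> Is; have [En Ea] := InvE _ _ Is.
have lt : (n - m.+1 < n)%N by lia.
have [t1 [s1 [ex1 le1 Is1]]] := step _ _ lt Is.
have Ej : (n - m.+1).+1 = (n - m)%N by lia.
rewrite Ej in Is1; have [t2 [s2 [ex2 le2 Is2]]] := IHm _ (ltnW lemn) Is1.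
exists (6 + (t1 + 6) + t2)%N, s2; split=> //; last by lia.
apply: ExecWhileTrue ex2; first by rewrite /= En Ea -ltnNge.
apply: ExecSeq ex1 _.
exact: (ExecNSet O a (NConst 0) (NAdd (counter a) (NConst 1)) s1).
Qed.

End Programs.

(** * The program and the invariants of its loops *)

Section Algorithm.
Local Open Scope ring_scope.

(* Natural arrays: 0 the size, 1 the set S0, 2 an independent set,
   3 and 4 the loop counters e and f. Real arrays: 0 the weights, 1 the output,
   2 the current shift. *)
Definition mem_S0 (i : nexpr) := BNle (NConst 1) (NGet 1 i).
Definition half_gap :=
  RDiv (RSub (RGet 0 (counter 4)) (RGet 0 (counter 3))) (RConst 2).
Definition set_mark k := NSet 2 (counter 4) (NConst k).

(** Marking is tentative and undone if the oracle rejects it. Elements can come in index order,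
    because only an inclusion-maximal independent subset of [heavier S0 w e] is wanted. *)
Definition greedy_step :=
  If (BAnd (mem_S0 (counter 4))
           (BNot (BRle (RGet 0 (counter 4)) (RGet 0 (counter 3)))))
     (Seq (set_mark 1) (If (BIndep 2) Skip (set_mark 0))) Skip.

(** The element is marked only for the duration of the oracle call, so the greedy set is the same
    for every [f]. *)
Definition scan_step :=
  If (mem_S0 (counter 4)) Skip
     (Seq (set_mark 1)
        (Seq (If (BAnd (BIndep 2) (BRle (RGet 2 (NConst 0)) half_gap))
                 (RSet 2 (NConst 0) half_gap) Skip)
             (set_mark 0))).

Definition outer_step :=
  If (mem_S0 (counter 3))
     (Seq (For 4 (set_mark 0)) (Seq (For 4 greedy_step) (For 4 scan_step)))
     Skip.

Definition output_step :=
  If (mem_S0 (counter 4))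
     (RSet 1 (counter 4) (RAdd (RGet 0 (counter 4)) (RGet 2 (NConst 0))))
     (RSet 1 (counter 4) (RSub (RGet 0 (counter 4)) (RGet 2 (NConst 0)))).

Definition IM_prog := Seq (For 3 outer_step) (For 4 output_step).

Variables (R : realType) (T : finType) (M : matroid T).
Variables (S0 : {set T}) (w : T -> R).
Implicit Types (s : state R) (x e f : T) (P : T -> T -> bool) (A B : {set T}).

Definition has_input s : Prop :=
  [/\ nmem s 0 0 = #|T|,
      forall x, nmem s 1 (enum_rank x) = (x \in S0)
    & forall x, rmem s 0 (enum_rank x) = w x].

Definition marked s : {set T} := [set x | nmem s 2 (enum_rank x) != 0%N].

Definition critical e f : bool :=
  [&& e \in S0, f \notin S0 & ~~ spans M (heavier S0 w e) f].

(* [d] is the maximum of 0 and the half gaps of the critical pairs in [P]. *)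
Definition shift_for P (d : R) : Prop :=
  [/\ 0 <= d, d = 0 \/ exists e f, critical e f /\ d = (w f - w e) / 2
    & forall e f, P e f -> critical e f -> (w f - w e) / 2 <= d].

Lemma shift_forS P P' e f d d' : shift_for P d ->
  (forall e' f', P' e' f' -> P e' f' \/ (e' = e /\ f' = f)) ->
  d' = (if critical e f && (d <= (w f - w e) / 2) then (w f - w e) / 2 else d) ->
  shift_for P' d'.
Proof.
move=> [d0 dE le_d] P'P ->; case: ifP => [/andP[cr le]|nle]; split=> //.
- exact: le_trans le.
- by right; exists e, f.
- move=> e' f' /P'P[/le_d le'|[-> ->] //] cr'; exact: le_trans (le' cr') le.
- move=> e' f' /P'P[/le_d //|[-> ->]] cr'.
  by move: nle; rewrite cr' /= => /negbT; rewrite -ltNge => /ltW.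
Qed.

(** Inclusion is required on critical pairs only, which lets the outer loop skip every [e] outside
    [S0]. *)
Lemma shift_for_sub P P' d : shift_for P d ->
  (forall e f, P' e f -> critical e f -> P e f) -> shift_for P' d.
Proof.
by move=> [d0 dE le_d] P'P; split=> // e f /P'P h /[dup] /h; apply: le_d.
Qed.

Lemma enum_rank_surj j : (j < #|T|)%N -> exists x, j = enum_rank x.
Proof. by move=> lt; exists (enum_val (Ordinal lt)); rewrite enum_valK. Qed.

Lemma enum_rank_ltS y x :
  (enum_rank y < (enum_rank x).+1)%N = (y == x) || (enum_rank y < enum_rank x)%N.
Proof. by rewrite ltnS leq_eqVlt val_eqE (inj_eq enum_rank_inj). Qed.

Lemma enum_rank_eq y x : (enum_rank y == enum_rank x :> nat) = (y == x).
Proof. by rewrite val_eqE (inj_eq enum_rank_inj). Qed.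

Lemma marked_upd1 (m : nat -> nat -> nat) r x :
  marked (State (upd m 2 (enum_rank x) 1%N) r) = x |: marked (State m r).
Proof.
apply/setP => y; rewrite !inE /= /upd eqxx /= enum_rank_eq.
by case: (y == x).
Qed.

Lemma marked_upd0 (m : nat -> nat -> nat) r x :
  marked (State (upd m 2 (enum_rank x) 0%N) r) = marked (State m r) :\ x.
Proof.
apply/setP => y; rewrite !inE /= /upd eqxx /= enum_rank_eq.
by case: (y == x).
Qed.

Lemma marked_counter a j s : a != 2 -> marked (set_counter a j s) = marked s.
Proof. by rewrite eq_sym /marked /set_counter /upd /= => /negPf ->. Qed.

Lemma indep_marked x s :
  indep_oracle M (fun i => upd (nmem s) 2 (enum_rank x) 1%N 2 i != 0%N) =
  indep M (x |: marked s).
Proof. by congr (indep M _); exact: (marked_upd1 (nmem s) (rmem s) x). Qed.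

(** Correctness of the greedy pass: an element rejected earlier stays dependent when [B] grows. *)
Lemma basis_in_step A B x : x \notin A -> basis_in M A B ->
  basis_in M (x |: A) (if indep M (x |: B) then x |: B else B).
Proof.
move=> xA /basis_inP[iB sBA maxB]; case: ifPn => ix; apply/basis_inP; split=> //.
- exact: setUS.
- move=> y /setU1P[->|yA]; first by rewrite setU11.
  rewrite !inE negb_or => /andP[_ yB]; apply: contra (maxB y yA yB).
  by apply: indepS; rewrite setUCA subsetUr.
- exact: subset_trans (subsetUr _ _).
- by move=> y /setU1P[->|] //; apply: maxB.
Qed.

(** * Correctness and cost of each loop *)

Definition at_e e d s : Prop :=
  [/\ has_input s, nmem s 3 0 = enum_rank e & rmem s 2 0 = d].

Lemma clear_runs e d s : at_e e d s ->
  runs (indep_oracle M) (For 4 (set_mark 0)) s (#|T| * 16 + 9)%N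
    (fun s' => at_e e d s' /\ marked s' = set0).
Proof.
move=> [inp E3 Ed].
pose Inv j s' := [/\ at_e e d s', nmem s' 4 0 = j
  & forall x, (enum_rank x < j)%N -> x \notin marked s'].
apply: (@runs_weaken _ _ _ _ (#|T| * (4 + 12) + 9)%N _ (Inv #|T|)) => // [|s' [ae _ un]].
  apply: runs_for => //.
  - by move=> j s' [[[-> _ _] _ _] -> _].
  - move=> j s' /enum_rank_surj[x ->] [[[En ES Ew] E3' Ed'] E4 un].
    apply: runs_loop_free => //=; split=> //=; first by rewrite /upd /= E4 addn1.
    move=> y; rewrite enum_rank_ltS.
    by rewrite marked_counter // E4 marked_upd0 in_setD1; case: eqP => //= _ /un.
split=> //; apply/setP => x; rewrite in_set0; apply/negbTE; exact: un.
Qed.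

Lemma greedy_runs e d s : at_e e d s -> marked s = set0 ->
  runs (indep_oracle M) (For 4 greedy_step) s (#|T| * 40 + 9)%N
    (fun s' => at_e e d s' /\ basis_in M (heavier S0 w e) (marked s')).
Proof.
move=> [inp E3 Ed] un; set A := heavier S0 w e.
have inA x : (x \in A) = (x \in S0) && (w e < w x) by rewrite inE.
clearbody A.
pose Inv j s' := [/\ at_e e d s', nmem s' 4 0 = j
  & basis_in M [set x in A | (enum_rank x < j)%N] (marked s')].
apply: (@runs_weaken _ _ _ _ (#|T| * (28 + 12) + 9)%N _ (Inv #|T|)) => [|//|s' [ae _ bA]];
  last first.
  split=> //.
  suff EA : [set x in A | (enum_rank x < #|T|)%N] = A by rewrite EA in bA.
  by apply/setP => x; rewrite inE ltn_ord andbT.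
apply: runs_for => //.
- split=> //; have -> : marked (set_counter 4 0 s) = set0 by [].
  apply/basis_inP; split=> [||x]; [exact: indep0 | exact: sub0set |].
  by rewrite inE andbF.
- by move=> j s' [[[-> _ _] _ _] -> _].
move=> j s' /enum_rank_surj[x ->] [[[En ES Ew] E3' Ed'] E4 bA].
set Aj := [set _ in A | _] in bA.
have xAj : x \notin Aj by rewrite inE ltnn andbF.
have Eb : [set y in A | (enum_rank y < (enum_rank x).+1)%N] =
    if x \in A then x |: Aj else Aj.
  case: ifPn => xA; apply/setP => y; rewrite !inE enum_rank_ltS;
    by case: (eqVneq y x) => [->|] //=; rewrite ?xA ?(negPf xA).
have xm : x \notin marked s'.
  apply: contra xAj; have /basis_inP[_ /subsetP sBA _] := bA.
  exact: sBA.
have Eu : upd (nmem s') 2 (enum_rank x) 1%N 4 0 = enum_rank x by rewrite /upd /= E4.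
have step := basis_in_step xAj bA.
apply: runs_loop_free => //.
rewrite /greedy_step /= !E4 E3' ES !Ew lt0b -ltNge -inA indep_marked Eu.
rewrite /Inv marked_counter // Eb; case: ifP => _; last first.
  by split=> //; rewrite /= /upd /= E4 addn1.
by case: ifP step => _ step; split=> //; rewrite ?(marked_upd0, marked_upd1) ?setU1K //;
  rewrite /= /upd /= E4 addn1.
Qed.

Lemma scan_runs e d s P :
  e \in S0 -> at_e e d s -> basis_in M (heavier S0 w e) (marked s) ->
  shift_for P d ->
  runs (indep_oracle M) (For 4 scan_step) s (#|T| * 60 + 9)%N
    (fun s' => exists2 d', at_e e d' s' &
       shift_for (fun e' f' => P e' f' || (e' == e)) d').
Proof.
move=> eS [inp E3 Ed] bA Pd; set B := marked s in bA.
(* Besides the pairs of [P], the first [j] pairs of row [e] have been handled. *)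
pose PP j e' f' := P e' f' || (e' == e) && (enum_rank f' < j)%N.
pose Inv j s' := [/\ nmem s' 4 0 = j, marked s' = B
  & exists2 d', at_e e d' s' & shift_for (PP j) d'].
apply: (@runs_weaken _ _ _ _ (#|T| * (48 + 12) + 9)%N _ (Inv #|T|)) => //; last first.
  move=> s' [_ _ [d' ae Pd']]; exists d' => //.
  by apply: shift_for_sub Pd' _ => e' f; rewrite /PP ltn_ord andbT.
apply: runs_for => //.
- split=> //; exists d => //; apply: shift_for_sub Pd _ => e' f.
  by rewrite /PP andbF orbF.
- by move=> j s' [-> _ [d' [[-> _ _]]]].
move=> j s' /enum_rank_surj[x ->] [E4 EB [d' [[En ES Ew] E3' Ed'] Pd']].
have PPS e' f : PP (enum_rank x).+1 e' f ->
    PP (enum_rank x) e' f \/ (e' = e /\ f = x).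
  rewrite /PP enum_rank_ltS; case/orP => [->|/andP[/eqP -> /orP[/eqP ->|->]]];
  by [left | right | rewrite eqxx orbT; left].
have Pstep := shift_forS Pd' PPS.
have Eu : upd (nmem s') 2 (enum_rank x) 1%N 4 0 = enum_rank x by rewrite /upd /= E4.
have Eu' : upd (nmem s') 2 (enum_rank x) 1%N 3 0 = enum_rank e by rewrite /upd /= E3'.
apply: runs_loop_free => //.
rewrite /scan_step /= !E4 ES lt0b.
case: ifPn => xS /=.
  split=> //; first by rewrite /= /upd /= E4 addn1.
  exists d' => //; apply: Pstep.
  by rewrite /critical xS andbF.
rewrite indep_marked !Eu !Eu' !Ew Ed'.
have xA : x \notin heavier S0 w e by rewrite inE negb_and xS.
(* The marked set is a basis of [heavier S0 w e], so the oracle's answer decides whether the pair is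
   critical. *)
have Ecr : critical e x = indep M (x |: marked s').
  by rewrite /critical eS xS (spansE xA bA) negbK EB.
have xm : x \notin marked s'.
  rewrite EB; apply: contra xA; have /basis_inP[_ /subsetP sBA _] := bA.
  exact: sBA.
rewrite -Ecr; case: ifP Pstep => _ /(_ _ erefl) Pd''; rewrite /= !Eu.
  split; first by rewrite /= /upd /= E4 addn1.
    by rewrite marked_counter // marked_upd0 marked_upd1 setU1K.
  by exists ((w x - w e) / 2).
split; first by rewrite /= /upd /= E4 addn1.
  by rewrite marked_counter // marked_upd0 marked_upd1 setU1K.
by exists d'.
Qed.

Lemma outer_runs s : has_input s -> rmem s 2 0 = 0 ->
  runs (indep_oracle M) (For 3 outer_step) s
    (#|T| * (#|T| * 116 + 50) + 9)%N
    (fun s' => has_input s' /\ shift_for (fun _ _ => true) (rmem s' 2%N 0%N)).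
Proof.
(* Rows with index below [j] are complete. The factor 116 below is 16 + 40 + 60, from the three
   inner loops. *)
move=> inp Ed; pose PP j (e f : T) := (enum_rank e < j)%N.
pose Inv j s' := [/\ has_input s', nmem s' 3 0 = j
  & shift_for (PP j) (rmem s' 2%N 0%N)].
apply: (@runs_weaken _ _ _ _ (#|T| * (#|T| * 116 + 38 + 12) + 9)%N _ (Inv #|T|)) => //.
- apply: runs_for => //.
  + by split=> //=; rewrite Ed; split=> //; left.
  + by move=> j s' [[-> _ _] -> _].
  move=> j s' /enum_rank_surj[e ->] [inp' E3 Pd].
  have ES : nmem s' 1 (enum_rank e) = (e \in S0) by case: inp'.
  apply: (@runs_weaken _ _ _ _ (5 + (#|T| * 116 + 27))%N) => [||s'' Q]; last exact: Q.
    apply: (@runs_if _ _ _ _ _ _ (#|T| * 116 + 27)%N).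
    rewrite /= E3 ES lt0b; case: ifPn => eS; last first.
      apply: runs_loop_free => //=; first by lia.
      split=> //=; first by rewrite /upd /= E3 addn1.
      apply: shift_for_sub Pd _ => e' f; rewrite /PP enum_rank_ltS.
      by case/orP => [/eqP ->|//]; rewrite /critical (negPf eS).
    have ae : at_e e (rmem s' 2 0) s' by [].
    pose k := (#|T| * 16 + 9 + (#|T| * 40 + 9 + (#|T| * 60 + 9)))%N.
    have le_k : (k <= #|T| * 116 + 27)%N by rewrite /k; move: #|T| => n; lia.
    apply: (@runs_weaken _ _ _ _ k) le_k _ => [|s'' Q]; last exact: Q.
    apply/runs_seq/(runs_weaken (clear_runs ae)) => // s1 [ae1 un].
    apply/runs_seq/(runs_weaken (greedy_runs ae1 un)) => // s2 [ae2 bA].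
    apply: (runs_weaken (scan_runs eS ae2 bA Pd)) => // s3 [d' [inp3 E33 Ed3] Pd'].
    split=> //; first by rewrite /= /upd /= E33 addn1.
    rewrite /= Ed3; apply: shift_for_sub Pd' _ => e' f; rewrite /PP enum_rank_ltS.
    by rewrite orbC.
  by rewrite /=; lia.
- by lia.
- move=> s' [inp' _ Pd]; split=> //.
  by apply: shift_for_sub Pd _ => e f _ _; rewrite /PP.
Qed.

Lemma output_runs s d : has_input s -> rmem s 2 0 = d ->
  runs (indep_oracle M) (For 4 output_step) s (#|T| * 40 + 9)%N
    (fun s' => IM_output s' =1 shift S0 w d).
Proof.
move=> inp Ed.
pose Inv j s' := [/\ has_input s', rmem s' 2 0 = d, nmem s' 4 0 = j
  & forall x, (enum_rank x < j)%N -> IM_output s' x = shift S0 w d x].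
apply: (@runs_weaken _ _ _ _ (#|T| * (28 + 12) + 9)%N _ (Inv #|T|)) => //; last first.
  by move=> s' [_ _ _ out] x; apply: out.
apply: runs_for => //.
  by move=> j s' [[-> _ _] _ -> _].
move=> j s' /enum_rank_surj[x ->] [[En ES Ew] Ed' E4 out].
apply: runs_loop_free => //.
rewrite /output_step /= E4 ES lt0b Ew Ed'.
case: ifPn => xS; (split=> //=; first by rewrite /= /upd /= E4 addn1);
  move=> y; rewrite enum_rank_ltS /IM_output /= /upd /= enum_rank_eq;
  by case: eqVneq => [-> _|_ /out //]; rewrite /shift ?xS ?(negPf xS).
Qed.

(** * Optimality of the output *)

Lemma has_input_IM_input : has_input (IM_input S0 w).
Proof. by split=> // x; rewrite /= valK enum_rankK. Qed.

Lemma eq_dist_inf (u v : T -> R) : u =1 v -> dist_inf w u = dist_inf w v.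
Proof. by move=> uv; apply: eq_bigr => x _; rewrite uv. Qed.

Lemma eq_feasible (u v : T -> R) :
  u =1 v -> IM_feasible M S0 u -> IM_feasible M S0 v.
Proof.
move=> uv [B [sB [bB maxB]]]; have E I : weight u I = weight v I by apply: eq_bigr.
by exists B; split=> //; split=> // B' /maxB; rewrite !E.
Qed.

Lemma IM_prog_runs : (exists2 B, basis M B & B \subset S0) ->
  runs (indep_oracle M) IM_prog (IM_input S0 w)
    (#|T| * (#|T| * 116 + 50) + 9 + (#|T| * 40 + 9))%N
    (fun s' => IM_optimal M S0 w (IM_output s') /\
               candidate S0 w (dist_inf w (IM_output s'))).
Proof.
move=> exB; apply: runs_seq.
apply: (runs_weaken (outer_runs has_input_IM_input erefl)) => // s1 [inp].
move Ed: (rmem s1 2 0) => d [d0 dE le_d].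
apply: (runs_weaken (output_runs inp Ed)) => // s2 out.
have Edist : dist_inf w (IM_output s2) = d.
  (* A nonzero [d] comes from a critical pair, whose [e] shows that [T] is nonempty; the case
     [d = 0] also covers an empty [T]. *)
  rewrite (eq_dist_inf out); case: dE => [->|[e _]]; first exact: dist_inf_shift0.
  exact: (dist_inf_shift S0 w e).
split; last first.
  rewrite Edist; case: dE => [|[e [f [/and3P[eS fS _] ->]]]]; first by left.
  (* The half gap has the opposite orientation, so it is the candidate with the minus sign. *)
  by right; exists e, f; split=> //; right; rewrite -mulNr opprB.
split.
  apply: (@eq_feasible (shift S0 w d)); first by move=> x; rewrite out.
  apply: shift_feasible => // e f eS fS nsp; apply: le_d => //.
  by rewrite /critical eS fS.
move=> u feas; rewrite Edist; case: dE => [->|]; first exact: dist_inf_ge0.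
move=> [e [f [/and3P[_ fS nsp] ->]]]; exact: feasible_dist_inf feas.
Qed.

End Algorithm.

Theorem theorem4p4 (R : realType) :
  exists (prog : cmd) (q : {poly nat}),
  forall (T : finType) (M : matroid T) (S0 : {set T}) (w : T -> R),
  (exists2 B : {set T}, basis M B & B \subset S0) ->
  exists (t : nat) (s' : state R),
    [/\ exec (indep_oracle M) prog (IM_input S0 w) t s',
        (t <= q.[#|T|]%R)%N,
        IM_optimal M S0 w (IM_output s')
      & candidate S0 w (dist_inf w (IM_output s'))].
Proof.
(* With n for [#|T|], the bound n(116n + 50) + 9 + 40n + 9 is 116n^2 + 90n + 18; coefficients are
   listed from the constant term up. *)
exists IM_prog, (Poly [:: 18%N; 90%N; 116%N]) => T M S0 w exB.
have [t [s' [ex le [opt cand]]]] := IM_prog_runs w exB.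
exists t, s'; split=> //; apply: leq_trans le _; rewrite horner_Poly /=.
nia.
Qed.
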